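(* Let $f\in\mathcal{L}^1(\mathbb{R})+BV_0(\mathbb{R})$ be such that $g(t):=t f(t)$ also belongs to $\mathcal{L}^1(\mathbb{R})+BV_0(\mathbb{R})$. Then $\mathcal{F}_{HK}(f)$ is continuously differentiable on $\mathbb{R}\setminus\{0\}$ and $$\frac{d}{ds}\mathcal{F}_{HK}(f)(s)=-i\,\mathcal{F}_{HK}(g)(s)\qquad (s\neq 0).$$
   Context: $BV_0(\mathbb{R})$: real functions of bounded variation on $\mathbb{R}$ vanishing at $\pm\infty$. $\mathcal{L}^1(\mathbb{R})+BV_0(\mathbb{R})$: functions $f=f_1+f_2$ with $f_1\in\mathcal{L}^1(\mathbb{R})$, $f_2\in BV_0(\mathbb{R})$. For such $f$ and $s\neq 0$, $\mathcal{F}_{HK}(f)(s)=\frac{1}{\sqrt{2\pi}}\int_{\mathbb{R}}e^{-isx}f(x)\,dx$, where the integral is the Henstock–Kurzweil integral over $\mathbb{R}$ (extending the Lebesgue and improper Riemann integrals; it exists for such $f$ and $s\neq0$). *)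

(* Defs.v *)
From Stdlib Require Import Reals Lra List Sorting.Sorted ClassicalEpsilon.
Open Scope R_scope.

(* Tagged divisions of a compact interval [a,b], fine with respect to a gauge
   delta : a list of pairs (t_i, x_i) describing consecutive intervals
   [x_{i-1}, x_i] (x_0 = a, last x_n = b) with tags t_i in [x_{i-1}, x_i]
   and [x_{i-1}, x_i] contained in (t_i - delta t_i, t_i + delta t_i). *)
Inductive tdiv (delta : R -> R) : R -> R -> list (R * R) -> Prop :=
| tdiv_nil : forall a, tdiv delta a a nil
| tdiv_cons : forall a t c b P,
    a < c -> a <= t <= c ->
    t - delta t < a -> c < t + delta t ->
    tdiv delta c b P -> tdiv delta a b ((t, c) :: P).

Fixpoint rsum (h : R -> R) (a : R) (P : list (R * R)) : R :=
  match P with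
  | nil => 0
  | (t, c) :: P' => h t * (c - a) + rsum h c P'
  end.

(* Henstock-Kurzweil integral over R (Bartle's definition via gauges on the
   extended real line [-oo,+oo]): the gauge at +-oo is given by M, the two
   unbounded pieces (-oo,a] and [b,+oo) are tagged at -oo, +oo, where the
   integrand is taken to be 0, so they contribute nothing to Riemann sums. *)
Definition HK_integral_R (h : R -> R) (I : R) : Prop :=
  forall eps, 0 < eps ->
  exists (delta : R -> R) (M : R),
    (forall x, 0 < delta x) /\ 0 < M /\
    forall a b P, a < - M -> M < b -> tdiv delta a b P ->
      Rabs (rsum h a P - I) < eps.

(* The value of the HK integral (meaningful when it exists). *)
Definition HK_int (h : R -> R) : R :=
  epsilon (inhabits 0) (HK_integral_R h).

Definition L1 (f : R -> R) : Prop :=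
  (exists I, HK_integral_R f I) /\
  (exists J, HK_integral_R (fun x => Rabs (f x)) J).

Fixpoint var_sum (f : R -> R) (l : list R) : R :=
  match l with
  | x :: ((y :: _) as l') => Rabs (f y - f x) + var_sum f l'
  | _ => 0
  end.

Definition bounded_variation (f : R -> R) : Prop :=
  exists V, forall l, Sorted Rle l -> var_sum f l <= V.

Definition vanishes_at_infty (f : R -> R) : Prop :=
  forall eps, 0 < eps -> exists M, forall x, M < Rabs x -> Rabs (f x) < eps.

Definition BV0 (f : R -> R) : Prop :=
  bounded_variation f /\ vanishes_at_infty f.

Definition L1_plus_BV0 (f : R -> R) : Prop :=
  exists f1 f2, L1 f1 /\ BV0 f2 /\ forall x, f x = f1 x + f2 x.

(* F_HK(f)(s) = 1/sqrt(2 pi) * int e^{-isx} f(x) dx, split into real and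
   imaginary parts: e^{-isx} = cos(sx) - i sin(sx). *)
Definition FHK_re (f : R -> R) (s : R) : R :=
  / sqrt (2 * PI) * HK_int (fun x => cos (s * x) * f x).

Definition FHK_im (f : R -> R) (s : R) : R :=
  - (/ sqrt (2 * PI) * HK_int (fun x => sin (s * x) * f x)).

(* Main.v *)
(** Let [g = t f(t) = g1 + g2] with [g1] in L1 and [g2] in BV0.  A Riemann sum of [k g] is bounded by
    [sup |k|] times the integral of [|g1|], plus [sup |K|] times the variation of [g2] by Abel summation,
    where [K' = k]; moreover the contribution of a neighbourhood of infinity carries an arbitrarily
    small weight.  For [k = cos (sigma x + th) - cos (s x + th)] both [k] and [K] are uniformly bounded
    (as [s <> 0]) and tend to 0 locally uniformly as [sigma -> s], so the Riemann sums of the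
    transform of [g] are equicontinuous in the frequency at [s], over suitable gauges.  Continuity
    follows, and so does differentiability, by the mean value theorem applied to a single finite sum:
    the frequency derivative of the sum for [f] is the sum for [g].
    Existence of the integrals: [int k g2] is [K g2 - int K dg2] and [int k g1] is a limit of
    [int k dU] with [U] a major function of [g1 >= 0]; both are Stieltjes integrals of a Lipschitz
    function against a monotone one, obtained as suprema of lower sums. *)
Require Import Defs.
From Stdlib Require Import Reals.
From Stdlib Require Import Lra Psatz List Sorting.Sorted ClassicalEpsilon.
Open Scope R_scope.

(** * Gauges, tagged divisions and Riemann sums *)

Lemma Rabs_le_inv x y : Rabs x <= y -> - y <= x <= y.
Proof. intros H. assert (H1 := Rle_abs x). assert (H2 := Rle_abs (- x)). rewrite Rabs_Ropp in H2. lra. Qed.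

Definition gauge (delta : R -> R) : Prop := forall x, 0 < delta x.

Lemma gauge_Rmin d1 d2 : gauge d1 -> gauge d2 -> gauge (fun x => Rmin (d1 x) (d2 x)).
Proof. intros H1 H2 x. apply Rmin_pos; auto. Qed.

Lemma tdiv_weaken d1 d2 a b P :
  (forall x, d1 x <= d2 x) -> tdiv d1 a b P -> tdiv d2 a b P.
Proof.
  intros Hd H; induction H as [|a t c b P Hac Ht H1 H2 H IH]; constructor; auto;
    specialize (Hd t); lra.
Qed.

Lemma tdiv_Rmin d1 d2 a b P :
  tdiv (fun x => Rmin (d1 x) (d2 x)) a b P -> tdiv d1 a b P /\ tdiv d2 a b P.
Proof.
  intros H; split; revert H; apply tdiv_weaken; intros x; [apply Rmin_l | apply Rmin_r].
Qed.

Lemma tdiv_le d a b P : tdiv d a b P -> a <= b.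
Proof. induction 1; lra. Qed.

Lemma tdiv_app d a b c P Q : tdiv d a b P -> tdiv d b c Q -> tdiv d a c (P ++ Q).
Proof. intros H HQ; induction H; simpl; auto; constructor; auto. Qed.

Lemma tdiv_single d u t v :
  u < v -> u <= t <= v -> t - d t < u -> v < t + d t -> tdiv d u v ((t, v) :: nil).
Proof. intros; constructor; auto; constructor. Qed.

Lemma rsum_app d h a b P Q :
  tdiv d a b P -> rsum h a (P ++ Q) = rsum h a P + rsum h b Q.
Proof. intros H; induction H; simpl; [ring | rewrite IHtdiv; ring]. Qed.

Lemma rsum_ext h1 h2 a P : (forall x, h1 x = h2 x) -> rsum h1 a P = rsum h2 a P.
Proof.
  intros H; revert a; induction P as [|[t c] P IH]; intros a; simpl; auto.
  now rewrite H, IH.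
Qed.

Lemma rsum_lin c1 h1 c2 h2 a P :
  rsum (fun x => c1 * h1 x + c2 * h2 x) a P = c1 * rsum h1 a P + c2 * rsum h2 a P.
Proof.
  revert a; induction P as [|[t c] P IH]; intros a; simpl; [ring | rewrite IH; ring].
Qed.

Lemma rsum_nonneg d h a b P : (forall x, 0 <= h x) -> tdiv d a b P -> 0 <= rsum h a P.
Proof.
  intros Hh H; induction H; simpl; [lra|].
  assert (0 <= h t * (c - a)) by (apply Rmult_le_pos; [auto|lra]). lra.
Qed.

Lemma rsum_Rabs_le d k g B a b P :
  (forall x, a <= x <= b -> Rabs (k x) <= B) -> tdiv d a b P ->
  Rabs (rsum (fun x => k x * g x) a P) <= B * rsum (fun x => Rabs (g x)) a P.
Proof.
  intros Hk H; induction H as [|a t c b P Hac Ht H1 H2 H IH]; simpl.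
  - rewrite Rabs_R0; lra.
  - pose proof (tdiv_le _ _ _ _ H) as Hcb.
    assert (IH' := IH (fun x Hx => Hk x (conj (Rle_trans _ _ _ (Rlt_le _ _ Hac) (proj1 Hx)) (proj2 Hx)))).
    assert (Hkt : Rabs (k t) <= B) by (apply Hk; lra).
    eapply Rle_trans; [apply Rabs_triang|].
    rewrite !Rabs_mult, (Rabs_right (c - a)) by lra.
    assert (Rabs (k t) * (Rabs (g t) * (c - a)) <= B * (Rabs (g t) * (c - a))).
    { apply Rmult_le_compat_r; auto. apply Rmult_le_pos; [apply Rabs_pos | lra]. }
    lra.
Qed.

(** Completeness applied to the right ends reachable by a fine division: their supremum [c] has a
    reachable point within its gauge, and one more cell tagged at [c] passes beyond [c] unless
    [c = b]. *)
Theorem cousin d a b : gauge d -> a <= b -> exists P, tdiv d a b P.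
Proof.
  intros Hd Hab.
  set (E := fun x => a <= x <= b /\ exists P, tdiv d a x P).
  assert (Ea : E a) by (split; [lra | exists nil; constructor]).
  destruct (completeness E) as [c [Hub Hlub]].
  { exists b; intros x [Hx _]; lra. }
  { now exists a. }
  assert (Hac : a <= c) by (apply Hub; auto).
  assert (Hcb : c <= b) by (apply Hlub; intros x [Hx _]; lra).
  pose proof (Hd c) as Hdc.
  assert (Hx : exists x, E x /\ c - d c < x).
  { apply NNPP; intros Hn.
    assert (c <= c - d c); [|lra].
    apply Hlub; intros x Ex. apply Rnot_lt_le; intros Hl. apply Hn; now exists x. }
  destruct Hx as [x [Ex Hxc]].
  assert (Hxc' : x <= c) by (apply Hub; auto).
  destruct Ex as [Hx [P HP]].
  set (y := Rmin b (c + d c / 2)).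
  assert (Hy : c <= y <= b /\ y < c + d c).
  { unfold y. repeat split; [apply Rmin_glb; lra | apply Rmin_l |].
    eapply Rle_lt_trans; [apply Rmin_r | lra]. }
  assert (Ey : exists Q, tdiv d a y Q).
  { destruct (Req_dec x y) as [<-|Hne]; [now exists P|].
    exists (P ++ (c, y) :: nil). apply tdiv_app with x; auto.
    apply tdiv_single; lra. }
  assert (Hyc : y <= c) by (apply Hub; split; [lra | auto]).
  assert (Hyb : y = b).
  { unfold y in *. destruct (Rle_or_lt b (c + d c / 2)) as [Hl|Hl].
    - now apply Rmin_left.
    - rewrite Rmin_right in Hyc; lra. }
  now rewrite <- Hyb.
Qed.

(* A telescoping interval function [H] approximates [h dx] piece by piece up to the interval function [W] minus [w dx]. *)
Lemma rsum_primitive d h w H W a b P :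
  (forall u t v, a <= u -> u < v -> v <= b -> u <= t <= v ->
     t - d t < u -> v < t + d t ->
     Rabs (h t * (v - u) - (H v - H u)) <= W v - W u - w t * (v - u)) ->
  tdiv d a b P ->
  Rabs (rsum h a P - (H b - H a)) <= W b - W a - rsum w a P.
Proof.
  intros Hp HP; induction HP as [a|a t c b P Hac Ht H1 H2 HP IH]; simpl.
  - rewrite Rabs_right; lra.
  - pose proof (tdiv_le _ _ _ _ HP) as Hcb.
    assert (Hc := Hp a t c (Rle_refl a) Hac Hcb Ht H1 H2).
    assert (IH' : Rabs (rsum h c P - (H b - H c)) <= W b - W c - rsum w c P).
    { apply IH; intros; apply Hp; auto; lra. }
    replace (h t * (c - a) + rsum h c P - (H b - H a))
      with ((h t * (c - a) - (H c - H a)) + (rsum h c P - (H b - H c))) by ring.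
    eapply Rle_trans; [apply Rabs_triang | lra].
Qed.

(** * Linearity of the integral and a criterion for its existence *)

Lemma HK_ext h1 h2 I : (forall x, h1 x = h2 x) -> HK_integral_R h1 I -> HK_integral_R h2 I.
Proof.
  intros He H eps Heps. destruct (H eps Heps) as [d [M [Hd [HM HP]]]].
  exists d, M; repeat split; auto. intros a b P Ha Hb HT.
  rewrite <- (rsum_ext h1 h2) by auto. eauto.
Qed.

Lemma HK_lin c1 h1 I1 c2 h2 I2 :
  HK_integral_R h1 I1 -> HK_integral_R h2 I2 ->
  HK_integral_R (fun x => c1 * h1 x + c2 * h2 x) (c1 * I1 + c2 * I2).
Proof.
  intros H1 H2 eps Heps.
  assert (Hc1 := Rabs_pos c1). assert (Hc2 := Rabs_pos c2).
  set (e := eps / (Rabs c1 + Rabs c2 + 1)).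
  assert (He : 0 < e) by (apply Rdiv_lt_0_compat; lra).
  assert (Hee : (Rabs c1 + Rabs c2 + 1) * e = eps) by (unfold e; field; lra).
  destruct (H1 e He) as [d1 [M1 [Hd1 [HM1 HP1]]]].
  destruct (H2 e He) as [d2 [M2 [Hd2 [HM2 HP2]]]].
  exists (fun x => Rmin (d1 x) (d2 x)), (Rmax M1 M2).
  assert (HMl := Rmax_l M1 M2). assert (HMr := Rmax_r M1 M2).
  split; [apply gauge_Rmin; auto|]. split; [lra|].
  intros a b P Ha Hb HT. destruct (tdiv_Rmin _ _ _ _ _ HT) as [HT1 HT2].
  assert (E1 := HP1 a b P ltac:(lra) ltac:(lra) HT1).
  assert (E2 := HP2 a b P ltac:(lra) ltac:(lra) HT2).
  rewrite rsum_lin.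
  replace (c1 * rsum h1 a P + c2 * rsum h2 a P - (c1 * I1 + c2 * I2))
    with (c1 * (rsum h1 a P - I1) + c2 * (rsum h2 a P - I2)) by ring.
  eapply Rle_lt_trans; [apply Rabs_triang|]. rewrite !Rabs_mult. nra.
Qed.

Lemma HK_int_spec h : (exists I, HK_integral_R h I) -> HK_integral_R h (HK_int h).
Proof. intros H. unfold HK_int. now apply epsilon_spec. Qed.

(** Cauchy form of finite limits at both ends, so that no limit has to be named. *)
Definition converges_at_ends (H : R -> R) : Prop :=
  forall eps, 0 < eps -> exists M, forall x y,
    (M < x /\ M < y) \/ (x < - M /\ y < - M) -> Rabs (H x - H y) <= eps.

Lemma converges_lin c1 H1 c2 H2 :
  converges_at_ends H1 -> converges_at_ends H2 ->
  converges_at_ends (fun x => c1 * H1 x + c2 * H2 x).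
Proof.
  intros C1 C2 eps Heps.
  assert (Hc1 := Rabs_pos c1). assert (Hc2 := Rabs_pos c2).
  set (e := eps / (Rabs c1 + Rabs c2 + 1)).
  assert (He : 0 < e) by (apply Rdiv_lt_0_compat; lra).
  assert (Hee : (Rabs c1 + Rabs c2 + 1) * e = eps) by (unfold e; field; lra).
  destruct (C1 e He) as [M1 HM1]. destruct (C2 e He) as [M2 HM2].
  exists (Rmax M1 M2). assert (HMl := Rmax_l M1 M2). assert (HMr := Rmax_r M1 M2).
  intros x y Hxy.
  assert (E1 := HM1 x y ltac:(lra)). assert (E2 := HM2 x y ltac:(lra)).
  replace (c1 * H1 x + c2 * H2 x - (c1 * H1 y + c2 * H2 y))
    with (c1 * (H1 x - H1 y) + c2 * (H2 x - H2 y)) by ring.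
  eapply Rle_trans; [apply Rabs_triang|]. rewrite !Rabs_mult. nra.
Qed.

Definition nondecreasing (p : R -> R) : Prop := forall x y, x <= y -> p x <= p y.

Definition bounded_by (C : R) (p : R -> R) : Prop := forall x, Rabs (p x) <= C.

(** A point [M] where [p] nearly attains its supremum bounds all later increments. The difference is
    signed and [x], [y] are unordered, so exchanging them gives the absolute value. *)
Lemma nondecreasing_tail_right p C eps :
  nondecreasing p -> bounded_by C p -> 0 < eps ->
  exists M, forall x y, M <= x -> M <= y -> p x - p y <= eps.
Proof.
  intros Hp HC Heps.
  destruct (completeness (fun r => exists x, r = p x)) as [m [Hub Hlub]].
  { exists C; intros r [x ->]. specialize (HC x). apply Rabs_le_inv in HC; lra. }
  { exists (p 0); now exists 0. }
  assert (Hx : exists M, m - eps < p M).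
  { apply NNPP; intros Hn. assert (m <= m - eps); [|lra].
    apply Hlub; intros r [x ->]. apply Rnot_lt_le; intros Hl; apply Hn; now exists x. }
  destruct Hx as [M HM]. exists M; intros x y Hx Hy.
  assert (p x <= m) by (apply Hub; now exists x).
  specialize (Hp M y Hy). lra.
Qed.

Lemma nondecreasing_tail p C eps :
  nondecreasing p -> bounded_by C p -> 0 < eps ->
  exists M, forall x y, (M <= x /\ M <= y) \/ (x <= - M /\ y <= - M) ->
    p x - p y <= eps.
Proof.
  intros Hp HC Heps.
  destruct (nondecreasing_tail_right p C eps Hp HC Heps) as [M1 H1].
  (* Reflection turns the left tail into a right one and keeps the function nondecreasing. *)
  destruct (nondecreasing_tail_right (fun x => - p (- x)) C eps) as [M2 H2]; auto.
  { intros x y Hxy. assert (p (- y) <= p (- x)) by (apply Hp; lra). lra. }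
  { intros x. rewrite Rabs_Ropp. apply HC. }
  exists (Rmax M1 M2). assert (HMl := Rmax_l M1 M2). assert (HMr := Rmax_r M1 M2).
  intros x y [[Hx Hy]|[Hx Hy]].
  - apply H1; lra.
  - specialize (H2 (- y) (- x)). rewrite !Ropp_involutive in H2.
    specialize (H2 ltac:(lra) ltac:(lra)). lra.
Qed.

Lemma nondecreasing_converges p C :
  nondecreasing p -> bounded_by C p -> converges_at_ends p.
Proof.
  intros Hp HC eps Heps.
  destruct (nondecreasing_tail p C eps Hp HC Heps) as [M HM]. exists M; intros x y Hxy.
  assert (H1 := HM x y ltac:(lra)). assert (H2 := HM y x ltac:(lra)).
  apply Rabs_le; lra.
Qed.

(* The integral is the supremum of the numbers that eventually bound the Riemann sums from below. *)
Lemma HK_exists_of_approx h :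
  (forall eps, 0 < eps -> exists d H M, gauge d /\ converges_at_ends H /\
     forall a b P, a < - M -> M < b -> tdiv d a b P ->
       Rabs (rsum h a P - (H b - H a)) <= eps) ->
  exists I, HK_integral_R h I.
Proof.
  intros Hyp.
  assert (Hyp' : forall eps, 0 < eps -> exists d M I, gauge d /\ 0 < M /\
     forall a b P, a < - M -> M < b -> tdiv d a b P -> Rabs (rsum h a P - I) <= eps).
  { intros eps Heps.
    destruct (Hyp (eps / 3) ltac:(lra)) as [d [H [M [Hd [HH HP]]]]].
    destruct (HH (eps / 3) ltac:(lra)) as [M' HM'].
    set (N := Rmax 1 (Rmax M M')).
    assert (HN : 1 <= N /\ M <= N /\ M' <= N).
    { unfold N. assert (A1 := Rmax_l 1 (Rmax M M')). assert (A2 := Rmax_r 1 (Rmax M M')).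
      assert (A3 := Rmax_l M M'). assert (A4 := Rmax_r M M'). lra. }
    (* Beyond [N] the function [H] moves by at most [eps / 3] at either end, so this increment is a
       candidate value independent of [a] and [b]. *)
    exists d, N, (H (N + 1) - H (- N - 1)). repeat split; auto; [lra|].
    intros a b P Ha Hb HT.
    assert (E1 := HP a b P ltac:(lra) ltac:(lra) HT).
    assert (E2 := HM' b (N + 1) ltac:(lra)).
    assert (E3 := HM' a (- N - 1) ltac:(lra)).
    apply Rabs_le_inv in E1, E2, E3. apply Rabs_le; lra. }
  clear Hyp.
  set (E := fun y => exists d M, gauge d /\
     forall a b P, a < - M -> M < b -> tdiv d a b P -> y <= rsum h a P).
  assert (HE1 : forall eps d M I, 0 < eps -> gauge d ->
     (forall a b P, a < - M -> M < b -> tdiv d a b P -> Rabs (rsum h a P - I) <= eps) ->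
     E (I - eps) /\ forall y, E y -> y <= I + eps).
  { intros eps d M I Heps Hd HP. split.
    - exists d, M; split; auto. intros a b P Ha Hb HT. specialize (HP a b P Ha Hb HT).
      apply Rabs_le_inv in HP; lra.
    - intros y [d' [M' [Hd' HP']]].
      set (N := Rmax 1 (Rmax M M')).
      assert (HN : 1 <= N /\ M <= N /\ M' <= N).
      { unfold N. assert (A1 := Rmax_l 1 (Rmax M M')). assert (A2 := Rmax_r 1 (Rmax M M')).
        assert (A3 := Rmax_l M M'). assert (A4 := Rmax_r M M'). lra. }
      (* A division fine for both gauges confronts the lower bound [y] with the estimate around
         [I]. *)
      destruct (cousin (fun x => Rmin (d x) (d' x)) (- N - 1) (N + 1)) as [P HT];
        [now apply gauge_Rmin | lra |].
      apply tdiv_Rmin in HT as [HT1 HT2].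
      assert (E1 := HP (- N - 1) (N + 1) P ltac:(lra) ltac:(lra) HT1).
      assert (E2 := HP' (- N - 1) (N + 1) P ltac:(lra) ltac:(lra) HT2).
      apply Rabs_le_inv in E1; lra. }
  destruct (Hyp' 1 Rlt_0_1) as [d0 [M0 [I0 [Hd0 [_ HP0]]]]].
  destruct (HE1 1 d0 M0 I0 Rlt_0_1 Hd0 HP0) as [E0 U0].
  destruct (completeness E) as [I [Hub Hlub]].
  { exists (I0 + 1); exact U0. }
  { now exists (I0 - 1). }
  exists I. intros eps Heps.
  destruct (Hyp' (eps / 3) ltac:(lra)) as [d [M [J [Hd [HM HP]]]]].
  exists d, M; repeat split; auto. intros a b P Ha Hb HT.
  destruct (HE1 (eps / 3) d M J ltac:(lra) Hd HP) as [EJ UJ].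
  apply Hub in EJ. assert (I <= J + eps / 3) by (apply Hlub; exact UJ).
  specialize (HP a b P Ha Hb HT). apply Rabs_le_inv in HP. apply Rabs_def1; lra.
Qed.

(** * Variation functions and Stieltjes integrals of Lipschitz functions *)

(** [- p x] is the variation of [g] on [[x, +oo)]: putting [x] before a chain that starts at [y]
    adds [|g y - g x|]. Measuring to the right makes this a mere cons. *)
Lemma bv_majorant g : bounded_variation g ->
  exists p C, bounded_by C p /\
    forall x y, x <= y -> Rabs (g y - g x) <= p y - p x.
Proof.
  intros [V HV].
  set (E := fun x r => exists l, Sorted Rle (x :: l) /\ r = var_sum g (x :: l)).
  assert (E0 : forall x, E x 0).
  { intros x; exists nil; auto. }
  assert (EV : forall x, is_upper_bound (E x) V).
  { intros x r [l [Hl ->]]; auto. }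
  set (w := fun x => proj1_sig (completeness (E x) (ex_intro _ V (EV x)) (ex_intro _ 0 (E0 x)))).
  assert (Hw : forall x, is_lub (E x) (w x)).
  { intros x; unfold w. destruct completeness; auto. }
  exists (fun x => - w x), V. split.
  - intros x. destruct (Hw x) as [Hu Hl]. rewrite Rabs_Ropp.
    assert (0 <= w x) by (apply Hu; apply E0). rewrite Rabs_right by lra. apply Hl, EV.
  - intros x y Hxy. destruct (Hw x) as [Hux Hlx]. destruct (Hw y) as [Huy Hly].
    assert (w y <= w x - Rabs (g y - g x)); [|lra].
    apply Hly. intros r [l [Hl ->]].
    assert (Rabs (g y - g x) + var_sum g (y :: l) <= w x); [|lra].
    apply Hux. exists (y :: l). split; auto.
Qed.

(* Values of lower Riemann-Stieltjes sums of [phi] with respect to [alpha] over intervals with left end the first real argument. *)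
Inductive lower_sum (phi alpha : R -> R) : R -> R -> Prop :=
| lower_sum_nil : forall a, lower_sum phi alpha a 0
| lower_sum_cons : forall a c m S,
    a <= c -> (forall x, a <= x <= c -> m <= phi x) ->
    lower_sum phi alpha c S -> lower_sum phi alpha a (m * (alpha c - alpha a) + S).

(** [- A x] is the supremum of the lower sums over [[x, +oo)], finite because [phi] and the total
    increase of [alpha] are bounded. With [phi >= 0] the empty sum is a legitimate lower sum for the
    whole half-line. *)
Lemma stieltjes_nonneg phi alpha C D :
  (forall x, 0 <= phi x <= C) -> nondecreasing alpha -> bounded_by D alpha ->
  exists A, (exists C', bounded_by C' A) /\
    forall u v m M, u <= v -> (forall x, u <= x <= v -> m <= phi x <= M) ->
      m * (alpha v - alpha u) <= A v - A u <= M * (alpha v - alpha u).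
Proof.
  intros Hphi Ha HD.
  set (E := lower_sum phi alpha).
  assert (E0 : forall x, E x 0) by (intros; constructor).
  assert (HC : 0 <= C) by (specialize (Hphi 0); lra).
  assert (HD' : forall x, - D <= alpha x <= D) by (intros; apply Rabs_le_inv, HD).
  assert (EB : forall x, is_upper_bound (E x) (C * (D - alpha x))).
  { intros x r H; induction H as [a|a c m S Hac Hm H IH].
    - apply Rmult_le_pos; auto. specialize (HD' a); lra.
    - assert (m <= C) by (specialize (Hm a); specialize (Hphi a); lra).
      specialize (Ha a c Hac). nra. }
  set (w := fun x => proj1_sig (completeness (E x) (ex_intro _ _ (EB x)) (ex_intro _ 0 (E0 x)))).
  assert (Hw : forall x, is_lub (E x) (w x)).
  { intros x; unfold w. destruct completeness; auto. }
  assert (Hw0 : forall x, 0 <= w x) by (intros x; apply (Hw x), E0).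
  exists (fun x => - w x). split.
  - exists (C * (D + D)). intros x. rewrite Rabs_Ropp, Rabs_right by (specialize (Hw0 x); lra).
    apply Rle_trans with (C * (D - alpha x)); [apply (Hw x), EB|].
    specialize (HD' x). apply Rmult_le_compat_l; lra.
  - intros u v m M Huv Hm. split.
    + assert (w v <= w u - m * (alpha v - alpha u)); [|lra].
      apply (Hw v). intros S HS.
      assert (m * (alpha v - alpha u) + S <= w u); [|lra].
      apply (Hw u). constructor; auto. intros x Hx; apply Hm; auto.
    + assert (w u <= M * (alpha v - alpha u) + w v); [|lra].
      apply (Hw u). intros S HS.
      assert (HM : forall x, u <= x <= v -> phi x <= M) by (intros x Hx; apply Hm, Hx).
      clear Hm m. revert Huv HM. induction HS as [u|u c m S Huc Hm H IH]; intros Huv HM.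
      * specialize (Hw0 v). specialize (Ha u v Huv).
        assert (0 <= M) by (specialize (HM u); specialize (Hphi u); lra). nra.
      * assert (Hmu : m <= M) by (specialize (HM u); specialize (Hm u); lra).
        (* Cells left of [v] go by induction; a cell straddling [v] is cut there, and its right part
           with the remaining cells is a lower sum starting at [v]. *)
        destruct (Rle_or_lt c v) as [Hcv|Hvc].
        -- assert (S <= M * (alpha v - alpha c) + w v) by (apply IH; auto; intros; apply HM; lra).
           specialize (Ha u c Huc). nra.
        -- assert (m * (alpha c - alpha v) + S <= w v).
           { apply (Hw v). constructor; auto; [lra|]. intros x Hx; apply Hm; lra. }
           specialize (Ha u v Huv). nra.
Qed.

Definition lipschitz (L : R) (k : R -> R) : Prop :=
  forall x y, Rabs (k x - k y) <= L * Rabs (x - y).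

(** Adding [B] makes [phi] nonnegative, and the surplus [B * alpha] is removed afterwards. The error
    is the oscillation of [phi] on the cell times the increment of [alpha]. *)
Lemma stieltjes_primitive phi alpha B D L :
  bounded_by B phi -> lipschitz L phi -> 0 <= L ->
  nondecreasing alpha -> bounded_by D alpha ->
  exists A, converges_at_ends A /\
    forall u t v, u <= t <= v ->
      Rabs (A v - A u - phi t * (alpha v - alpha u)) <= L * (v - u) * (alpha v - alpha u).
Proof.
  intros HB HL HL0 Ha HD.
  destruct (stieltjes_nonneg (fun x => phi x + B) alpha (2 * B) D) as [A [[C' HC'] HA]]; auto.
  { intros x. specialize (HB x). apply Rabs_le_inv in HB. lra. }
  assert (HB0 : forall x, - B <= phi x) by (intros x; apply (Rabs_le_inv _ _ (HB x))).
  exists (fun x => 1 * A x + (- B) * alpha x). split.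
  - apply converges_lin; [|now apply nondecreasing_converges with D].
    apply nondecreasing_converges with C'; auto.
    intros u v Huv. destruct (HA u v 0 (2 * B)) as [H _]; [auto| |lra].
    intros x _. specialize (HB x). apply Rabs_le_inv in HB. lra.
  - intros u t v Ht.
    destruct (HA u v (phi t + B - L * (v - u)) (phi t + B + L * (v - u))) as [H1 H2]; [lra| |].
    { intros x Hx. specialize (HL x t). apply Rabs_le_inv in HL.
      assert (Rabs (x - t) <= v - u) by (apply Rabs_le; lra).
      assert (L * Rabs (x - t) <= L * (v - u)) by (apply Rmult_le_compat_l; auto). lra. }
    apply Rabs_le. lra.
Qed.

(** * Existence of the integrals of [k g] *)

(* Gauge of size about [eta / (1 + t^2)], with [Z] a multiple of [atan]: summing squares of lengths over the whole line stays below [eta]. *)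
Lemma mesh_gauge eta : 0 < eta -> exists d Z, gauge d /\ nondecreasing Z /\
  (forall x, 0 <= Z x <= eta) /\
  forall u t v, u <= t <= v -> t - d t < u -> v < t + d t ->
    (v - u) * (v - u) <= Z v - Z u /\ v - u <= eta.
Proof.
  (* [Z] stays within [[0, 18 * e * PI]] and [PI <= 4], whence [72 = 18 * 4]; the cap 1 keeps cells
     shorter than 2. *)
  intros Heta. set (e := Rmin 1 (eta / 72)).
  assert (He : 0 < e <= 1 /\ e <= eta / 72).
  { unfold e. repeat split; [apply Rmin_pos; lra | apply Rmin_l | apply Rmin_r]. }
  assert (Hpi := PI_4). assert (Hpi0 := PI_RGT_0).
  exists (fun t => e / (1 + t * t)), (fun x => 18 * e * (atan x + PI / 2)).
  split; [|split; [|split]].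
  - intros x. apply Rdiv_lt_0_compat; nra.
  - intros x y Hxy. destruct (Req_dec x y) as [->|Hne]; [lra|].
    assert (atan x < atan y) by (apply atan_increasing; lra). nra.
  - intros x. assert (Hb := atan_bound x). nra.
  - intros u t v Ht H1 H2.
    assert (Hd : 0 < e / (1 + t * t)) by (apply Rdiv_lt_0_compat; nra).
    assert (Hde : e / (1 + t * t) * (1 + t * t) = e) by (field; nra).
    assert (Hd1 : e / (1 + t * t) <= e) by nra.
    set (r := e / (1 + t * t)) in *.
    split; [|lra].
    destruct (Req_dec u v) as [->|Hne]; [lra|].
    destruct (MVT_cor2 atan (fun x => / (1 + x ^ 2)) u v ltac:(lra)) as [c [Hc Hcuv]].
    { intros c _. apply derivable_pt_lim_atan. }
    replace (18 * e * (atan v + PI / 2) - 18 * e * (atan u + PI / 2))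
      with (18 * e * (atan v - atan u)) by ring.
    rewrite Hc. replace (c ^ 2) with (c * c) by ring.
    (* From [c^2 = 2 (c - t)^2 + 2 t^2 - (c - 2 t)^2] one gets [c^2 <= 8 + 2 t^2]. The factor 9,
       doubled by the two sides of the tag, is the 18 in [Z]. *)
    assert (Hcc : 1 + c * c <= 9 * (1 + t * t)).
    { assert (Hct : - 2 <= c - t <= 2) by lra.
      assert ((c - t) * (c - t) <= 4) by nra.
      assert (Hs := Rle_0_sqr (c - 2 * t)). assert (Ht2 := Rle_0_sqr t). unfold Rsqr in *. lra. }
    assert (Hic : (1 + c * c) * / (1 + c * c) = 1) by (field; nra).
    assert (Hic0 : 0 < / (1 + c * c)) by (apply Rinv_0_lt_compat; nra).
    set (i := / (1 + c * c)) in *.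
    assert (Hri : r <= 9 * e * i).
    { apply Rmult_le_reg_r with (1 + t * t); [nra|]. rewrite Hde.
      assert (1 <= i * (9 * (1 + t * t))) by nra. nra. }
    assert (v - u <= 18 * e * i) by lra. nra.
Qed.

(* [K' = k], with a uniform quadratic error term. *)
Definition kernel (k K : R -> R) (L : R) : Prop :=
  forall u t v, u <= t <= v ->
    Rabs (K v - K u - k t * (v - u)) <= L * ((v - u) * (v - u)).

Lemma BV0_majorant g : BV0 g -> exists p C, bounded_by C p /\ bounded_by C g /\
  nondecreasing p /\ forall x y, x <= y -> Rabs (g y - g x) <= p y - p x.
Proof.
  intros [Hbv _]. destruct (bv_majorant g Hbv) as [p [C [HC Hp]]].
  exists p, (Rabs (g 0) + 2 * C).
  assert (HC' : forall x, - C <= p x <= C) by (intros; apply Rabs_le_inv, HC).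
  assert (HC0 := HC' 0). assert (Hg0 := Rabs_pos (g 0)). repeat split; auto.
  - intros x. specialize (HC x); lra.
  - intros x. replace (g x) with ((g x - g 0) + g 0) by ring.
    eapply Rle_trans; [apply Rabs_triang|]. specialize (HC' x).
    destruct (Rle_or_lt 0 x) as [Hx|Hx].
    + specialize (Hp 0 x Hx). lra.
    + specialize (Hp x 0 (Rlt_le _ _ Hx)). rewrite Rabs_minus_sym in Hp. lra.
  - intros x y Hxy. specialize (Hp x y Hxy). assert (H := Rabs_pos (g y - g x)). lra.
Qed.

(** With [g] frozen at the tag, replacing [k dx] by [dK] costs only the quadratic kernel error. *)
Lemma kernel_piece k K L g C u t v :
  kernel k K L -> bounded_by C g -> u <= t <= v ->
  Rabs (k t * g t * (v - u) - g t * (K v - K u)) <= C * (L * ((v - u) * (v - u))).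
Proof.
  intros Hk HC Ht.
  replace (k t * g t * (v - u) - g t * (K v - K u))
    with (g t * (- (K v - K u - k t * (v - u)))) by ring.
  rewrite Rabs_mult, Rabs_Ropp. apply Rmult_le_compat; auto using Rabs_pos.
Qed.

(* Integration by parts: [K g - int K dg] is a primitive of [k g], where [dg] is the difference of two monotone Stieltjes measures. *)
Lemma integrable_kernel_BV0 k K L B g : 0 < L -> 0 < B ->
  kernel k K L -> bounded_by B K -> lipschitz L K -> BV0 g ->
  exists I, HK_integral_R (fun x => k x * g x) I.
Proof.
  intros HL HB Hk HKB HKL Hg.
  destruct (BV0_majorant g Hg) as [p [C [HpC [HgC [Hp Hgp]]]]].
  assert (HC : 0 <= C) by (specialize (HpC 0); assert (H := Rabs_pos (p 0)); lra).
  (* [g = p - q] is a Jordan decomposition into bounded nondecreasing functions. *)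
  set (q := fun x => p x - g x).
  assert (Hq : nondecreasing q).
  { intros x y Hxy. unfold q. specialize (Hgp x y Hxy). apply Rabs_le_inv in Hgp. lra. }
  assert (HqC : bounded_by (2 * C) q).
  { intros x; unfold q. specialize (HpC x); specialize (HgC x).
    apply Rabs_le_inv in HpC, HgC. apply Rabs_le; lra. }
  destruct (stieltjes_primitive K p B C L) as [Ap [HApc HAp]]; auto; [lra|].
  destruct (stieltjes_primitive K q B (2 * C) L) as [Aq [HAqc HAq]]; auto; [lra|].
  apply HK_exists_of_approx. intros eps Heps.
  (* [p] increases by at most [2 * C] and [q] by at most [4 * C]; with the quadratic term the error
     is at most [7 * C * L * eta]. The [+ 1] keeps the divisor positive when [C = 0]. *)
  set (eta := eps / (L * (8 * C + 1))).
  assert (HLC : 0 < L * (8 * C + 1)) by (apply Rmult_lt_0_compat; lra).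
  assert (Heta : 0 < eta) by (apply Rdiv_lt_0_compat; auto).
  assert (Hee : L * (8 * C + 1) * eta = eps) by (unfold eta; field; lra).
  destruct (mesh_gauge eta Heta) as [d [Z [Hd [HZ [HZb HdZ]]]]].
  set (H := fun x => 1 * (K x * g x) + (-1) * (1 * Ap x + (-1) * Aq x)).
  exists d, H, 0.
  split; [auto|]. split.
  - unfold H. repeat apply converges_lin; auto. intros e He. destruct Hg as [_ Hv].
    destruct (Hv (e / (2 * B)) ltac:(apply Rdiv_lt_0_compat; lra)) as [M HM].
    (* Since [K] is bounded and [g] vanishes at infinity, the boundary term tends to 0. *)
    assert (HKg : forall x, M < Rabs x -> Rabs (K x * g x) <= e / 2).
    { intros x Hx. rewrite Rabs_mult. replace (e / 2) with (B * (e / (2 * B))) by (field; lra).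
      apply Rmult_le_compat; auto using Rabs_pos. apply Rlt_le; auto. }
    exists M. intros x y Hxy.
    assert (Hx : M < Rabs x /\ M < Rabs y).
    { assert (A1 := Rle_abs x). assert (A2 := Rle_abs y).
      assert (A3 := Rle_abs (- x)). assert (A4 := Rle_abs (- y)).
      rewrite Rabs_Ropp in A3, A4. lra. }
    assert (E1 := HKg x (proj1 Hx)). assert (E2 := HKg y (proj2 Hx)).
    apply Rabs_le_inv in E1, E2. apply Rabs_le; lra.
  - intros a b P _ _ HT.
    eapply Rle_trans.
    + apply (rsum_primitive d (fun x => k x * g x) (fun _ => 0) H
        (fun x => C * L * Z x + L * eta * (p x + q x)) a b P); [|exact HT].
      intros u t v _ Huv _ Ht H1 H2.
      destruct (HdZ u t v Ht H1 H2) as [Hsq Hm].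
      assert (E0 := kernel_piece k K L g C u t v Hk HgC Ht).
      (* The cell is cut at its tag, with [K] taken at the outer ends: [K v * g v - K u * g u]
         equals [g t * (K v - K u) + K v * (g v - g t) + K u * (g t - g u)]. *)
      assert (Epv := HAp t v v ltac:(lra)). assert (Epu := HAp u u t ltac:(lra)).
      assert (Eqv := HAq t v v ltac:(lra)). assert (Equ := HAq u u t ltac:(lra)).
      assert (P1 := Hp t v ltac:(lra)). assert (P2 := Hp u t ltac:(lra)).
      assert (Q1 := Hq t v ltac:(lra)). assert (Q2 := Hq u t ltac:(lra)).
      assert (Hmono : forall x y z, 0 <= x <= eta -> z <= y -> L * x * (y - z) <= L * eta * (y - z)).
      { intros x y z Hx Hyz. apply Rmult_le_compat_r; [lra|]. apply Rmult_le_compat_l; lra. }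
      assert (M1 := Hmono (v - t) (p v) (p t) ltac:(lra) P1).
      assert (M2 := Hmono (t - u) (p t) (p u) ltac:(lra) P2).
      assert (M3 := Hmono (v - t) (q v) (q t) ltac:(lra) Q1).
      assert (M4 := Hmono (t - u) (q t) (q u) ltac:(lra) Q2).
      assert (M5 : C * (L * ((v - u) * (v - u))) <= C * L * (Z v - Z u)).
      { rewrite <- Rmult_assoc. apply Rmult_le_compat_l; auto. apply Rmult_le_pos; lra. }
      match goal with |- Rabs ?X <= _ =>
        replace X with ((k t * g t * (v - u) - g t * (K v - K u))
          + (Ap v - Ap t - K v * (p v - p t)) + (Ap t - Ap u - K u * (p t - p u))
          - (Aq v - Aq t - K v * (q v - q t)) - (Aq t - Aq u - K u * (q t - q u)))
          by (unfold H, q; ring) end.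
      apply Rabs_le_inv in E0, Epv, Epu, Eqv, Equ. apply Rabs_le; lra.
    (* Zero is given the shape of a combination with null coefficients so that [rsum_lin] collapses
       the sum. *)
    + rewrite (rsum_ext (fun _ => 0) (fun x => 0 * 0 + 0 * 0)) by (intros; ring).
      rewrite (rsum_lin 0 (fun _ => 0) 0 (fun _ => 0)).
      assert (Pa := HpC a). assert (Pb := HpC b). assert (Qa := HqC a). assert (Qb := HqC b).
      apply Rabs_le_inv in Pa, Pb, Qa, Qb.
      assert (Za := HZb a). assert (Zb := HZb b).
      assert (HCL : 0 <= C * L) by (apply Rmult_le_pos; lra).
      assert (C * L * (Z b - Z a) <= C * L * eta) by (apply Rmult_le_compat_l; lra).
      assert (HLe : 0 < L * eta) by (apply Rmult_lt_0_compat; lra).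
      assert (L * eta * (p b + q b - (p a + q a)) <= L * eta * (6 * C)) by (apply Rmult_le_compat_l; lra).
      rewrite !Rmult_0_l. nra.
Qed.

(** The upper bound holds on every interval because Cousin's theorem extends a division past
    [[-M, M]], adding only nonnegative terms. *)
Lemma integrable_nonneg_bound g J : (forall x, 0 <= g x) -> HK_integral_R g J ->
  forall eps, 0 < eps -> exists d M, gauge d /\ 0 < M /\
    (forall a b P, tdiv d a b P -> rsum g a P <= J + eps) /\
    (forall a b P, a < - M -> M < b -> tdiv d a b P -> J - eps <= rsum g a P).
Proof.
  intros Hg HJ eps Heps. destruct (HJ eps Heps) as [d [M [Hd [HM HP]]]].
  exists d, M; repeat split; auto.
  - intros a b P HT. pose proof (tdiv_le _ _ _ _ HT) as Hab.
    set (a' := Rmin a (- M - 1)). set (b' := Rmax b (M + 1)).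
    assert (Ha : a' <= a /\ a' < - M).
    { unfold a'. assert (H1 := Rmin_l a (- M - 1)). assert (H2 := Rmin_r a (- M - 1)). lra. }
    assert (Hb : b <= b' /\ M < b').
    { unfold b'. assert (H1 := Rmax_l b (M + 1)). assert (H2 := Rmax_r b (M + 1)). lra. }
    destruct (cousin d a' a Hd ltac:(lra)) as [P1 T1].
    destruct (cousin d b b' Hd ltac:(lra)) as [P2 T2].
    assert (T := tdiv_app _ _ _ _ _ _ T1 (tdiv_app _ _ _ _ _ _ HT T2)).
    assert (E := HP a' b' _ ltac:(lra) ltac:(lra) T).
    rewrite (rsum_app d g a' a), (rsum_app d g a b) in E by auto.
    assert (N1 := rsum_nonneg d g _ _ _ Hg T1). assert (N2 := rsum_nonneg d g _ _ _ Hg T2).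
    apply Rabs_def2 in E. lra.
  - intros a b P Ha Hb HT. specialize (HP a b P Ha Hb HT). apply Rabs_def2 in HP. lra.
Qed.

(* Perron's major function: the supremum of the Riemann sums over divisions starting at [x], negated. *)
Lemma integrable_nonneg_major g J : (forall x, 0 <= g x) -> HK_integral_R g J ->
  forall eps, 0 < eps -> exists d M U, gauge d /\ 0 < M /\
    nondecreasing U /\ (forall x, - (J + eps) <= U x <= 0) /\
    (forall u t v, u < v -> u <= t <= v -> t - d t < u -> v < t + d t ->
       g t * (v - u) <= U v - U u) /\
    (forall a b P, a < - M -> M < b -> tdiv d a b P -> J - eps <= rsum g a P).
Proof.
  intros Hg HJ eps Heps.
  destruct (integrable_nonneg_bound g J Hg HJ eps Heps) as [d [M [Hd [HM [Hub Hlb]]]]].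
  set (E := fun x r => exists b P, tdiv d x b P /\ r = rsum g x P).
  assert (E0 : forall x, E x 0) by (intros x; exists x, nil; split; [constructor | auto]).
  assert (EV : forall x, is_upper_bound (E x) (J + eps)).
  { intros x r [b [P [HT ->]]]. eauto. }
  set (w := fun x => proj1_sig (completeness (E x) (ex_intro _ _ (EV x)) (ex_intro _ 0 (E0 x)))).
  assert (Hw : forall x, is_lub (E x) (w x)).
  { intros x; unfold w. destruct completeness; auto. }
  exists d, M, (fun x => - w x). repeat split; auto.
  - intros x y Hxy. destruct (cousin d x y Hd Hxy) as [Q HQ].
    assert (w y <= w x); [|lra]. apply (Hw y). intros r [b [P [HT ->]]].
    apply Rle_trans with (rsum g x (Q ++ P)).
    + rewrite (rsum_app d g x y) by auto. assert (H := rsum_nonneg d g _ _ _ Hg HQ). lra.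
    + apply (Hw x). exists b, (Q ++ P). split; auto. eapply tdiv_app; eauto.
  - assert (w x <= J + eps); [|lra]. apply (Hw x), EV.
  - assert (0 <= w x); [|lra]. apply (Hw x), E0.
  - intros u t v Huv Ht H1 H2. assert (w v <= w u - g t * (v - u)); [|lra].
    apply (Hw v). intros r [b [P [HT ->]]].
    assert (g t * (v - u) + rsum g v P <= w u); [|lra].
    apply (Hw u). exists b, ((t, v) :: P). split; auto. constructor; auto.
Qed.

(* Replacing [g dx] by [dU] costs little, and [int k dU] exists as a Stieltjes integral. *)
Lemma integrable_mult_nonneg k B L g J : 0 < B -> 0 < L ->
  bounded_by B k -> lipschitz L k -> (forall x, 0 <= g x) -> HK_integral_R g J ->
  exists I, HK_integral_R (fun x => k x * g x) I.
Proof.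
  intros HB HL HkB HkL Hg HJ. apply HK_exists_of_approx. intros eps Heps.
  (* Increments of [U] are at most [J + e] and sums of [g] over long intervals at least [J - e]: the
     gap [2 * e], weighted by [B], costs [eps / 2]. The oscillation of [k] gets the other half. *)
  set (e := eps / (4 * B)).
  assert (He : 0 < e) by (apply Rdiv_lt_0_compat; lra).
  assert (HBe : B * e = eps / 4) by (unfold e; field; lra).
  destruct (integrable_nonneg_major g J Hg HJ e He) as [d1 [M [U [Hd1 [HM [HU [HUb [Hmaj Hlb]]]]]]]].
  assert (HJe : 0 <= J + e) by (specialize (HUb 0); lra).
  destruct (stieltjes_primitive k U B (J + e) L) as [A [HAc HA]]; auto; [lra| |].
  { intros x. specialize (HUb x). apply Rabs_le; lra. }
  set (eta := eps / (2 * L * (J + e + 1))).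
  assert (Heta : 0 < eta) by (apply Rdiv_lt_0_compat; [lra | apply Rmult_lt_0_compat; lra]).
  assert (HLe : L * eta * (J + e + 1) = eps / 2) by (unfold eta; field; lra).
  assert (HLeta : 0 < L * eta) by (apply Rmult_lt_0_compat; lra).
  destruct (mesh_gauge eta Heta) as [d2 [Z [Hd2 [_ [_ HdZ]]]]].
  exists (fun x => Rmin (d1 x) (d2 x)), A, M.
  split; [now apply gauge_Rmin|]. split; [auto|]. intros a b P Ha Hb HT.
  eapply Rle_trans.
  - apply (rsum_primitive (fun x => Rmin (d1 x) (d2 x)) (fun x => k x * g x) (fun x => B * g x + 0 * g x) A
        (fun x => (B + L * eta) * U x) a b P); [|exact HT].
    intros u t v _ Huv _ Ht H1 H2.
    assert (Hl := Rmin_l (d1 t) (d2 t)). assert (Hr := Rmin_r (d1 t) (d2 t)).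
    destruct (HdZ u t v Ht ltac:(lra) ltac:(lra)) as [_ Hm].
    assert (Hj := Hmaj u t v Huv Ht ltac:(lra) ltac:(lra)).
    assert (E1 := HA u t v Ht). assert (HUuv := HU u v ltac:(lra)).
    assert (E2 : L * (v - u) * (U v - U u) <= L * eta * (U v - U u)).
    { apply Rmult_le_compat_r; [lra|]. apply Rmult_le_compat_l; lra. }
    assert (E3 : Rabs (k t * (g t * (v - u) - (U v - U u))) <= B * (U v - U u - g t * (v - u))).
    { rewrite Rabs_mult, (Rabs_left1 (_ - _)) by lra.
      eapply Rle_trans; [apply Rmult_le_compat_r; [lra | apply HkB]|]. lra. }
    replace (k t * g t * (v - u) - (A v - A u))
      with (k t * (g t * (v - u) - (U v - U u)) - (A v - A u - k t * (U v - U u))) by ring.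
    apply Rabs_le_inv in E1, E3. apply Rabs_le; lra.
  - rewrite rsum_lin, Rmult_0_l.
    assert (HS := Hlb a b P Ha Hb (proj1 (tdiv_Rmin _ _ _ _ _ HT))).
    assert (HUa := HUb a). assert (HUb' := HUb b).
    assert (B * (U b - U a - rsum g a P) <= B * (2 * e)) by (apply Rmult_le_compat_l; lra).
    assert (L * eta * (U b - U a) <= L * eta * (J + e + 1)) by (apply Rmult_le_compat_l; lra).
    lra.
Qed.

(** Writing [g = |g| - (|g| - g)] reduces to nonnegative integrable factors. *)
Lemma integrable_mult_L1 k B L g : 0 < B -> 0 < L ->
  bounded_by B k -> lipschitz L k -> L1 g ->
  exists I, HK_integral_R (fun x => k x * g x) I.
Proof.
  intros HB HL HkB HkL [[I HI] [J HJ]].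
  destruct (integrable_mult_nonneg k B L (fun x => Rabs (g x)) J) as [I1 H1]; auto.
  { intros; apply Rabs_pos. }
  destruct (integrable_mult_nonneg k B L (fun x => 1 * Rabs (g x) + (-1) * g x) (1 * J + (-1) * I))
    as [I2 H2]; auto.
  { intros x. assert (H := Rle_abs (g x)). lra. }
  { now apply HK_lin. }
  exists (1 * I1 + (-1) * I2). eapply HK_ext; [|apply (HK_lin 1 _ I1 (-1) _ I2 H1 H2)].
  intros x; simpl; ring.
Qed.

Lemma integrable_kernel k K L B g : 0 < L -> 0 < B ->
  kernel k K L -> bounded_by B k -> bounded_by B K -> lipschitz L k -> lipschitz L K ->
  L1_plus_BV0 g -> exists I, HK_integral_R (fun x => k x * g x) I.
Proof.
  intros HL HB Hk HkB HKB HkL HKL [g1 [g2 [H1 [H2 Hg]]]].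
  destruct (integrable_mult_L1 k B L g1) as [I1 HI1]; auto.
  destruct (integrable_kernel_BV0 k K L B g2) as [I2 HI2]; auto.
  exists (1 * I1 + 1 * I2). eapply HK_ext; [|apply (HK_lin 1 _ I1 1 _ I2 HI1 HI2)].
  intros x; simpl. rewrite Hg; ring.
Qed.

(** * Uniform bounds for Riemann sums over families of kernels *)

(* Uniform control of the Riemann sums of [k g]: the weight [V] serves every symmetric interval, the weight [eps] its complement.
   The gauge depends on the kernel only through [L], which makes the bound usable for a whole family of kernels at once. *)
Definition kernel_sums_controlled (g : R -> R) (V : R) : Prop :=
  forall eps, 0 < eps -> exists N, 0 < N /\ forall L eta, 0 < L -> 0 < eta ->
  exists d, gauge d /\ forall k K a b P B,
    kernel k K L -> tdiv d a b P ->
    (forall x, a <= x <= b -> Rabs (k x) <= B /\ Rabs (K x) <= B) ->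
    (a <= - N -> N <= b -> Rabs (rsum (fun x => k x * g x) a P) <= B * V + eta) /\
    (N <= a \/ b <= - N -> Rabs (rsum (fun x => k x * g x) a P) <= B * eps + eta).

(** Bounding [k] by [B] leaves sums of [|g|]. A filler joining the tail to the far side of [[-M, M]]
    already carries at least [J - e], and filler plus tail at most [J + e], so the tail keeps at
    most [2 * e <= eps]. *)
Lemma kernel_sums_L1 g : L1 g -> exists V, 0 <= V /\ kernel_sums_controlled g V.
Proof.
  intros [_ [J HJ]]. exists (Rabs J + 1). split; [assert (H := Rabs_pos J); lra|].
  intros eps Heps. set (e := Rmin 1 (eps / 2)).
  assert (He : 0 < e <= 1 /\ e <= eps / 2).
  { unfold e. repeat split; [apply Rmin_pos; lra | apply Rmin_l | apply Rmin_r]. }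
  assert (Hg : forall x, 0 <= Rabs (g x)) by (intros; apply Rabs_pos).
  destruct (integrable_nonneg_bound _ J Hg HJ e (proj1 (proj1 He))) as [d [M [Hd [HM [Hub Hlb]]]]].
  exists (M + 1). split; [lra|]. intros L eta _ Heta. exists d. split; auto.
  intros k K a b P B _ HT HB. pose proof (tdiv_le _ _ _ _ HT) as Hab.
  assert (HB0 : 0 <= B).
  { destruct (HB a ltac:(lra)) as [H _]. assert (H' := Rabs_pos (k a)). lra. }
  assert (Hs := rsum_Rabs_le d k g B a b P (fun x Hx => proj1 (HB x Hx)) HT).
  assert (HS : forall c, rsum (fun x => Rabs (g x)) a P <= c ->
     Rabs (rsum (fun x => k x * g x) a P) <= B * c + eta).
  { intros c Hc. assert (H : B * rsum (fun x => Rabs (g x)) a P <= B * c)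
      by (apply Rmult_le_compat_l; auto). lra. }
  split.
  - intros Ha Hb. apply HS. specialize (Hub a b P HT). assert (H := Rle_abs J). lra.
  - intros Hor. apply HS. destruct Hor as [Ha|Hb].
    + destruct (cousin d (- (M + 1)) a Hd ltac:(lra)) as [Q HQ].
      assert (E1 := Hlb (- (M + 1)) a Q ltac:(lra) ltac:(lra) HQ).
      assert (E2 := Hub _ _ _ (tdiv_app _ _ _ _ _ _ HQ HT)).
      rewrite (rsum_app d _ _ a) in E2 by auto. lra.
    + destruct (cousin d b (M + 1) Hd ltac:(lra)) as [Q HQ].
      assert (E1 := Hlb b (M + 1) Q ltac:(lra) ltac:(lra) HQ).
      assert (E2 := Hub _ _ _ (tdiv_app _ _ _ _ _ _ HT HQ)).
      rewrite (rsum_app d _ _ b) in E2 by auto. lra.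
Qed.

(* Abel summation, written as the product rule [g dK = d(K g) - K dg] on each piece. *)
Lemma kernel_sum_by_parts d Z k K L g p C B a b P :
  kernel k K L -> bounded_by C g -> 0 <= C * L ->
  (forall x y, x <= y -> Rabs (g y - g x) <= p y - p x) ->
  (forall u t v, u <= t <= v -> t - d t < u -> v < t + d t ->
     (v - u) * (v - u) <= Z v - Z u) ->
  (forall x, a <= x <= b -> Rabs (K x) <= B) ->
  tdiv d a b P ->
  Rabs (rsum (fun x => k x * g x) a P - (K b * g b - K a * g a))
    <= B * (p b - p a) + C * L * (Z b - Z a).
Proof.
  intros Hk HC HCL Hgp HZ HB HT.
  eapply Rle_trans.
  - apply (rsum_primitive d (fun x => k x * g x) (fun _ => 0) (fun x => K x * g x)
      (fun x => B * p x + C * L * Z x) a b P); [|exact HT].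
    intros u t v Ha Huv Hb Ht H1 H2.
    assert (E0 := kernel_piece k K L g C u t v Hk HC Ht).
    assert (Hz := HZ u t v Ht H1 H2).
    assert (M5 : C * (L * ((v - u) * (v - u))) <= C * L * (Z v - Z u)).
    { rewrite <- Rmult_assoc. apply Rmult_le_compat_l; auto. }
    assert (E1 : Rabs (K v * (g v - g t)) <= B * (p v - p t)).
    { rewrite Rabs_mult. apply Rmult_le_compat; try apply Rabs_pos; [apply HB | apply Hgp]; lra. }
    assert (E2 : Rabs (K u * (g t - g u)) <= B * (p t - p u)).
    { rewrite Rabs_mult. apply Rmult_le_compat; try apply Rabs_pos; [apply HB | apply Hgp]; lra. }
    replace (k t * g t * (v - u) - (K v * g v - K u * g u))
      with ((k t * g t * (v - u) - g t * (K v - K u))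
            - K v * (g v - g t) - K u * (g t - g u)) by ring.
    apply Rabs_le_inv in E0, E1, E2. apply Rabs_le; lra.
  - rewrite (rsum_ext (fun _ => 0) (fun x => 0 * 0 + 0 * 0)) by (intros; ring).
    rewrite (rsum_lin 0 (fun _ => 0) 0 (fun _ => 0)). lra.
Qed.

(** Abel summation leaves two boundary terms and the variation. In units of [B] these are at most
    [C], [C] and [2 * C], whence [V = 4 * C]; beyond [N] each is at most [eps / 3]. *)
Lemma kernel_sums_BV0 g : BV0 g -> exists V, 0 <= V /\ kernel_sums_controlled g V.
Proof.
  intros Hg. destruct (BV0_majorant g Hg) as [p [C [HpC [HgC [Hp Hgp]]]]].
  assert (HC : 0 <= C) by (specialize (HpC 0); assert (H := Rabs_pos (p 0)); lra).
  exists (4 * C). split; [lra|]. intros eps Heps.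
  destruct (nondecreasing_tail p C (eps / 3) Hp HpC ltac:(lra)) as [M1 HM1].
  destruct Hg as [_ Hv]. destruct (Hv (eps / 3) ltac:(lra)) as [M2 HM2].
  (* [M2 + 1] because the decay of [g] is known only strictly beyond [M2]. *)
  set (N := Rmax 1 (Rmax M1 (M2 + 1))).
  assert (HN : 1 <= N /\ M1 <= N /\ M2 + 1 <= N).
  { unfold N. assert (A1 := Rmax_l 1 (Rmax M1 (M2 + 1))). assert (A2 := Rmax_r 1 (Rmax M1 (M2 + 1))).
    assert (A3 := Rmax_l M1 (M2 + 1)). assert (A4 := Rmax_r M1 (M2 + 1)). lra. }
  exists N. split; [lra|]. intros L eta HL Heta.
  set (e := eta / (C * L + 1)).
  assert (HCL : 0 <= C * L) by (apply Rmult_le_pos; lra).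
  assert (He : 0 < e) by (apply Rdiv_lt_0_compat; lra).
  assert (Hee : C * L * e + e = eta) by (unfold e; field; lra).
  destruct (mesh_gauge e He) as [d [Z [Hd [_ [HZb HdZ]]]]].
  exists d; split; auto. intros k K a b P B Hk HT HB. pose proof (tdiv_le _ _ _ _ HT) as Hab.
  assert (HB0 : 0 <= B).
  { destruct (HB a ltac:(lra)) as [H _]. assert (H' := Rabs_pos (k a)). lra. }
  assert (HS := kernel_sum_by_parts d Z k K L g p C B a b P Hk HgC HCL Hgp
    (fun u t v Ht H1 H2 => proj1 (HdZ u t v Ht H1 H2)) (fun x Hx => proj2 (HB x Hx)) HT).
  assert (HZe : C * L * (Z b - Z a) <= C * L * e).
  { apply Rmult_le_compat_l; auto. assert (A1 := HZb a). assert (A2 := HZb b). lra. }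
  assert (HKg : forall x c, a <= x <= b -> Rabs (g x) <= c -> Rabs (K x * g x) <= B * c).
  { intros x c Hx Hc. rewrite Rabs_mult. apply Rmult_le_compat; auto using Rabs_pos.
    apply HB; auto. }
  split.
  - intros Ha Hb.
    assert (E1 := HKg a C ltac:(lra) (HgC a)). assert (E2 := HKg b C ltac:(lra) (HgC b)).
    assert (E3 : B * (p b - p a) <= B * (2 * C)).
    { apply Rmult_le_compat_l; auto. assert (A1 := HpC a). assert (A2 := HpC b).
      apply Rabs_le_inv in A1, A2. lra. }
    apply Rabs_le_inv in HS, E1, E2. apply Rabs_le; lra.
  - intros Hor.
    assert (Hx : M2 < Rabs a /\ M2 < Rabs b).
    { assert (A1 := Rle_abs a). assert (A2 := Rle_abs b).
      assert (A3 := Rle_abs (- a)). assert (A4 := Rle_abs (- b)).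
      rewrite Rabs_Ropp in A3, A4. lra. }
    assert (E1 := HKg a (eps / 3) ltac:(lra) (Rlt_le _ _ (HM2 a (proj1 Hx)))).
    assert (E2 := HKg b (eps / 3) ltac:(lra) (Rlt_le _ _ (HM2 b (proj2 Hx)))).
    assert (E3 : B * (p b - p a) <= B * (eps / 3)).
    { apply Rmult_le_compat_l; auto. apply HM1. lra. }
    apply Rabs_le_inv in HS, E1, E2. apply Rabs_le; lra.
Qed.

Lemma kernel_sums_L1_plus_BV0 g :
  L1_plus_BV0 g -> exists V, 0 <= V /\ kernel_sums_controlled g V.
Proof.
  intros [g1 [g2 [H1 [H2 Hg]]]].
  destruct (kernel_sums_L1 g1 H1) as [V1 [HV1 C1]].
  destruct (kernel_sums_BV0 g2 H2) as [V2 [HV2 C2]].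
  exists (V1 + V2). split; [lra|]. intros eps Heps.
  destruct (C1 (eps / 2) ltac:(lra)) as [N1 [HN1 D1]].
  destruct (C2 (eps / 2) ltac:(lra)) as [N2 [HN2 D2]].
  exists (Rmax N1 N2). assert (A1 := Rmax_l N1 N2). assert (A2 := Rmax_r N1 N2).
  split; [lra|]. intros L eta HL Heta.
  destruct (D1 L (eta / 2) HL ltac:(lra)) as [d1 [Hd1 E1]].
  destruct (D2 L (eta / 2) HL ltac:(lra)) as [d2 [Hd2 E2]].
  exists (fun x => Rmin (d1 x) (d2 x)). split; [now apply gauge_Rmin|].
  intros k K a b P B Hk HT HB. apply tdiv_Rmin in HT as [T1 T2].
  destruct (E1 k K a b P B Hk T1 HB) as [F1 G1].
  destruct (E2 k K a b P B Hk T2 HB) as [F2 G2].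
  rewrite (rsum_ext _ (fun x => 1 * (k x * g1 x) + 1 * (k x * g2 x)))
    by (intros; rewrite Hg; ring).
  rewrite rsum_lin. split.
  - intros Ha Hb. specialize (F1 ltac:(lra) ltac:(lra)). specialize (F2 ltac:(lra) ltac:(lra)).
    apply Rabs_le_inv in F1, F2. apply Rabs_le; lra.
  - intros Hor. specialize (G1 ltac:(lra)). specialize (G2 ltac:(lra)).
    apply Rabs_le_inv in G1, G2. apply Rabs_le; lra.
Qed.

(** * Trigonometric kernels and their dependence on the frequency *)

Lemma cos_lipschitz x y : Rabs (cos x - cos y) <= Rabs (x - y).
Proof.
  assert (H : forall x y, x < y -> Rabs (cos x - cos y) <= Rabs (x - y)).
  { clear x y; intros x y Hxy. destruct (MVT_cor2 cos (fun z => - sin z) x y Hxy) as [c [Hc _]].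
    { intros; apply derivable_pt_lim_cos. }
    rewrite (Rabs_minus_sym (cos x)), (Rabs_minus_sym x), Hc, Rabs_mult, Rabs_Ropp.
    assert (Hs : Rabs (sin c) <= 1) by (apply Rabs_le, SIN_bound).
    rewrite <- (Rmult_1_l (Rabs (y - x))) at 2. apply Rmult_le_compat_r; auto using Rabs_pos. }
  destruct (Rtotal_order x y) as [Hl|[->|Hg]]; auto.
  - rewrite !Rminus_diag, Rabs_R0. lra.
  - rewrite (Rabs_minus_sym (cos x)), (Rabs_minus_sym x). auto.
Qed.

Lemma sin_lipschitz x y : Rabs (sin x - sin y) <= Rabs (x - y).
Proof.
  rewrite <- (cos_shift x), <- (cos_shift y).
  eapply Rle_trans; [apply cos_lipschitz|].
  replace (PI / 2 - x - (PI / 2 - y)) with (- (x - y)) by ring. rewrite Rabs_Ropp. lra.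
Qed.

Lemma derivable_pt_lim_sin_affine s th x :
  derivable_pt_lim (fun y => sin (s * y + th)) x (s * cos (s * x + th)).
Proof.
  replace (s * cos (s * x + th)) with (cos (s * x + th) * (s * 1 + 0)) by ring.
  apply (derivable_pt_lim_comp (fun y => s * y + th) sin).
  - apply derivable_pt_lim_plus; [|apply derivable_pt_lim_const].
    apply derivable_pt_lim_scal, derivable_pt_lim_id.
  - apply derivable_pt_lim_sin.
Qed.

(** The mean value theorem turns the increment of [K] into [k c * (v - u)], and [k] has Lipschitz
    constant [|s|]. The phase [th] lets one statement serve cosine, sine and their derivatives in
    [s]. *)
Lemma kernel_cos s th : s <> 0 ->
  kernel (fun x => cos (s * x + th)) (fun x => / s * sin (s * x + th)) (Rabs s).
Proof.
  intros Hs u t v Ht. destruct (Req_dec u v) as [<-|Hne].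
  - rewrite !Rminus_diag, !Rmult_0_r, Rminus_diag, Rabs_R0. lra.
  - destruct (MVT_cor2 (fun x => / s * sin (s * x + th)) (fun x => cos (s * x + th)) u v
      ltac:(lra)) as [c [Hc Hcuv]].
    { intros c _. replace (cos (s * c + th)) with (/ s * (s * cos (s * c + th))) by (field; auto).
      apply derivable_pt_lim_scal, derivable_pt_lim_sin_affine. }
    rewrite Hc. replace (cos (s * c + th) * (v - u) - cos (s * t + th) * (v - u))
      with ((cos (s * c + th) - cos (s * t + th)) * (v - u)) by ring.
    rewrite Rabs_mult, (Rabs_right (v - u)), <- Rmult_assoc by lra.
    apply Rmult_le_compat_r; [lra|].
    eapply Rle_trans; [apply cos_lipschitz|].
    replace (s * c + th - (s * t + th)) with (s * (c - t)) by ring.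
    rewrite Rabs_mult. apply Rmult_le_compat_l; [apply Rabs_pos | apply Rabs_le; lra].
Qed.

(** The primitive [sin (s * x + th) / s] is 1-Lipschitz and bounded by [1 / |s|]; the summands 1 in
    [L] and [B] let the same constants serve [k] and [K]. *)
Lemma integrable_cos_mult g s th : s <> 0 -> L1_plus_BV0 g ->
  exists I, HK_integral_R (fun x => cos (s * x + th) * g x) I.
Proof.
  intros Hs Hg. assert (Hs0 := Rabs_pos_lt s Hs).
  assert (His := Rabs_pos (/ s)).
  apply integrable_kernel with (K := fun x => / s * sin (s * x + th))
    (L := Rabs s + 1) (B := 1 + Rabs (/ s)); auto; try lra.
  - intros u t v Ht. eapply Rle_trans; [apply kernel_cos; auto|].
    apply Rmult_le_compat_r; [nra | lra].
  - intros x. assert (H : Rabs (cos (s * x + th)) <= 1) by (apply Rabs_le, COS_bound). lra.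
  - intros x. rewrite Rabs_mult.
    assert (H : Rabs (sin (s * x + th)) <= 1) by (apply Rabs_le, SIN_bound). nra.
  - intros x y. eapply Rle_trans; [apply cos_lipschitz|].
    replace (s * x + th - (s * y + th)) with (s * (x - y)) by ring.
    rewrite Rabs_mult. apply Rmult_le_compat_r; [apply Rabs_pos | lra].
  - intros x y. rewrite <- Rmult_minus_distr_l, Rabs_mult.
    assert (H := sin_lipschitz (s * x + th) (s * y + th)).
    replace (s * x + th - (s * y + th)) with (s * (x - y)) in H by ring.
    rewrite Rabs_mult in H.
    apply Rle_trans with (Rabs (/ s) * (Rabs s * Rabs (x - y))).
    + apply Rmult_le_compat_l; auto.
    + rewrite Rabs_inv, <- Rmult_assoc, Rinv_l, Rmult_1_l by lra.
      assert (H0 := Rabs_pos (x - y)). nra.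
Qed.

(** Keeps [sigma] away from the singular frequency 0, with [1 / |sigma| <= 2 / |s|]. *)
Lemma frequency_gap s sigma : s <> 0 -> Rabs (sigma - s) <= Rabs s / 2 ->
  sigma <> 0 /\ Rabs s / 2 <= Rabs sigma <= 3 / 2 * Rabs s.
Proof.
  intros Hs H. assert (Hs0 := Rabs_pos_lt s Hs).
  assert (H1 : Rabs s <= Rabs sigma + Rabs (sigma - s)).
  { replace s with (sigma - (sigma - s)) at 1 by ring. unfold Rminus at 1.
    eapply Rle_trans; [apply Rabs_triang|]. rewrite Rabs_Ropp. lra. }
  assert (H2 : Rabs sigma <= Rabs s + Rabs (sigma - s)).
  { replace sigma with (s + (sigma - s)) at 1 by ring. apply Rabs_triang. }
  split; [|lra]. intros ->. rewrite Rabs_R0 in H1. lra.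
Qed.

(** The two kernel constants add up to [|sigma| + |s| <= 5 / 2 * |s|]. The resulting constant
    depends on [s] alone, so one gauge serves all nearby [sigma]. *)
Lemma kernel_cos_difference s sigma th : s <> 0 -> Rabs (sigma - s) <= Rabs s / 2 ->
  kernel (fun x => cos (sigma * x + th) - cos (s * x + th))
    (fun x => / sigma * sin (sigma * x + th) - / s * sin (s * x + th)) (3 * Rabs s).
Proof.
  intros Hs Hd u t v Ht. destruct (frequency_gap s sigma Hs Hd) as [Hsig Hb].
  assert (E1 := kernel_cos sigma th Hsig u t v Ht). assert (E2 := kernel_cos s th Hs u t v Ht).
  cbv beta in E1, E2.
  assert (Hq : 0 <= (v - u) * (v - u)) by nra.
  assert (Rabs sigma * ((v - u) * (v - u)) <= 3 / 2 * Rabs s * ((v - u) * (v - u)))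
    by (apply Rmult_le_compat_r; lra).
  assert (0 <= Rabs s * ((v - u) * (v - u))) by (apply Rmult_le_pos; auto using Rabs_pos).
  apply Rabs_le_inv in E1, E2. apply Rabs_le; lra.
Qed.

Lemma kernel_cos_difference_bound s sigma th x : s <> 0 -> Rabs (sigma - s) <= Rabs s / 2 ->
  Rabs (cos (sigma * x + th) - cos (s * x + th)) <= 2 + 3 / Rabs s /\
  Rabs (/ sigma * sin (sigma * x + th) - / s * sin (s * x + th)) <= 2 + 3 / Rabs s.
Proof.
  intros Hs Hd. destruct (frequency_gap s sigma Hs Hd) as [Hsig Hb].
  assert (Hs0 := Rabs_pos_lt s Hs).
  assert (Hi : 0 < 3 / Rabs s) by (apply Rdiv_lt_0_compat; lra).
  split.
  - assert (A1 := COS_bound (sigma * x + th)). assert (A2 := COS_bound (s * x + th)).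
    apply Rabs_le; lra.
  - unfold Rminus. eapply Rle_trans; [apply Rabs_triang|].
    rewrite Rabs_Ropp, !Rabs_mult, !Rabs_inv.
    assert (S1 : Rabs (sin (sigma * x + th)) <= 1) by (apply Rabs_le, SIN_bound).
    assert (S2 : Rabs (sin (s * x + th)) <= 1) by (apply Rabs_le, SIN_bound).
    assert (I1 : / Rabs sigma <= / (Rabs s / 2)) by (apply Rinv_le_contravar; lra).
    assert (I2 : / (Rabs s / 2) = 2 * / Rabs s) by (field; lra).
    assert (P1 : 0 < / Rabs sigma) by (apply Rinv_0_lt_compat; lra).
    assert (P2 : 0 < / Rabs s) by (apply Rinv_0_lt_compat; lra).
    assert (/ Rabs sigma * Rabs (sin (sigma * x + th)) <= / Rabs sigma * 1)
      by (apply Rmult_le_compat_l; lra).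
    assert (/ Rabs s * Rabs (sin (s * x + th)) <= / Rabs s * 1)
      by (apply Rmult_le_compat_l; lra).
    unfold Rdiv. lra.
Qed.

(** In [D] the term [N] bounds [k]; for [K], the change of the sine gives [2 * N / |s|] and the
    change of the factor [/ sigma] gives [2 / |s|^2]. *)
Lemma kernel_cos_difference_small s sigma th N x : s <> 0 ->
  Rabs (sigma - s) <= Rabs s / 2 -> Rabs x <= N ->
  let D := N + 2 * N / Rabs s + 2 / (Rabs s * Rabs s) in
  Rabs (cos (sigma * x + th) - cos (s * x + th)) <= Rabs (sigma - s) * D /\
  Rabs (/ sigma * sin (sigma * x + th) - / s * sin (s * x + th)) <= Rabs (sigma - s) * D.
Proof.
  intros Hs Hd Hx D. destruct (frequency_gap s sigma Hs Hd) as [Hsig Hb].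
  assert (Hs0 := Rabs_pos_lt s Hs).
  assert (HN : 0 <= N) by (assert (H := Rabs_pos x); lra).
  assert (Hh := Rabs_pos (sigma - s)).
  assert (P2 : 0 < / Rabs s) by (apply Rinv_0_lt_compat; lra).
  assert (D1 : 0 <= 2 * N / Rabs s) by (apply Rmult_le_pos; lra).
  assert (D2 : 0 < 2 / (Rabs s * Rabs s)) by (apply Rdiv_lt_0_compat; nra).
  assert (HxN : Rabs (sigma * x + th - (s * x + th)) <= Rabs (sigma - s) * N).
  { replace (sigma * x + th - (s * x + th)) with ((sigma - s) * x) by ring.
    rewrite Rabs_mult. apply Rmult_le_compat_l; auto. }
  split.
  - eapply Rle_trans; [apply cos_lipschitz|]. eapply Rle_trans; [apply HxN|].
    apply Rmult_le_compat_l; auto. unfold D; lra.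
  - replace (/ sigma * sin (sigma * x + th) - / s * sin (s * x + th))
      with (/ sigma * (sin (sigma * x + th) - sin (s * x + th))
            + - ((sigma - s) * (/ sigma * / s)) * sin (s * x + th)) by (field; auto).
    eapply Rle_trans; [apply Rabs_triang|].
    rewrite !Rabs_mult, Rabs_Ropp, !Rabs_mult, !Rabs_inv.
    assert (S2 : Rabs (sin (s * x + th)) <= 1) by (apply Rabs_le, SIN_bound).
    assert (S1 := Rle_trans _ _ _ (sin_lipschitz (sigma * x + th) (s * x + th)) HxN).
    assert (I1 : / Rabs sigma <= / (Rabs s / 2)) by (apply Rinv_le_contravar; lra).
    assert (I2 : / (Rabs s / 2) = 2 * / Rabs s) by (field; lra).
    assert (P1 : 0 < / Rabs sigma) by (apply Rinv_0_lt_compat; lra).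
    rewrite I2 in I1.
    assert (T1 : / Rabs sigma * Rabs (sin (sigma * x + th) - sin (s * x + th))
            <= 2 * / Rabs s * (Rabs (sigma - s) * N)).
    { apply Rmult_le_compat; auto using Rabs_pos; lra. }
    assert (T2 : / Rabs sigma * / Rabs s <= 2 * / Rabs s * / Rabs s)
      by (apply Rmult_le_compat_r; lra).
    assert (T3 : 0 <= / Rabs sigma * / Rabs s) by (apply Rmult_le_pos; lra).
    assert (T4 : Rabs (sigma - s) * (/ Rabs sigma * / Rabs s) * Rabs (sin (s * x + th))
            <= Rabs (sigma - s) * (2 * / Rabs s * / Rabs s) * 1).
    { apply Rmult_le_compat; auto using Rabs_pos.
      - apply Rmult_le_pos; auto.
      - apply Rmult_le_compat_l; auto. }
    assert (D3 : 2 / (Rabs s * Rabs s) = 2 * / Rabs s * / Rabs s) by (field; lra).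
    assert (T5 : 0 <= Rabs (sigma - s) * N) by (apply Rmult_le_pos; auto).
    unfold D. rewrite D3. unfold Rdiv. lra.
Qed.

(** * Continuity and differentiation in the frequency *)

(* Arbitrarily fine divisions of arbitrarily long intervals whose cosine sums are equicontinuous in the frequency. *)
Lemma cos_sums_equicontinuous g s th : s <> 0 -> L1_plus_BV0 g ->
  forall eps, 0 < eps -> exists h0, 0 < h0 /\ h0 <= Rabs s / 2 /\
  forall d M, gauge d -> exists a b P, a < - M /\ M < b /\ tdiv d a b P /\
    forall sigma, Rabs (sigma - s) <= h0 ->
      Rabs (rsum (fun x => cos (sigma * x + th) * g x) a P
            - rsum (fun x => cos (s * x + th) * g x) a P) <= eps.
Proof.
  intros Hs Hg eps Heps. assert (Hs0 := Rabs_pos_lt s Hs).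
  destruct (kernel_sums_L1_plus_BV0 g Hg) as [V [HV HC]].
  set (B0 := 2 + 3 / Rabs s).
  assert (HB0 : 0 < B0).
  { unfold B0. assert (0 < 3 / Rabs s) by (apply Rdiv_lt_0_compat; lra). lra. }
  (* Error budget: [eps / 8] for each tail, [eps / 4] for the middle, and [eps / 12] from the gauge
     for each of the three. *)
  destruct (HC (eps / (8 * B0)) ltac:(apply Rdiv_lt_0_compat; lra)) as [N [HN HNL]].
  destruct (HNL (3 * Rabs s) (eps / 12) ltac:(lra) ltac:(lra)) as [dc [Hdc Hsum]].
  set (D := N + 2 * N / Rabs s + 2 / (Rabs s * Rabs s)).
  assert (HD : 0 < D).
  { unfold D. assert (0 < 2 * N / Rabs s) by (apply Rdiv_lt_0_compat; lra).
    assert (0 < 2 / (Rabs s * Rabs s)) by (apply Rdiv_lt_0_compat; nra). lra. }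
  assert (HDV : 0 <= D * V) by (apply Rmult_le_pos; lra).
  set (h0 := Rmin (Rabs s / 2) (eps / (4 * (D * V + 1)))).
  assert (He4 : 0 < eps / (4 * (D * V + 1))) by (apply Rdiv_lt_0_compat; lra).
  assert (Hh0 : 0 < h0) by (apply Rmin_pos; lra).
  assert (Hl : h0 <= Rabs s / 2) by apply Rmin_l.
  assert (Hr : h0 <= eps / (4 * (D * V + 1))) by apply Rmin_r.
  (* [h0] is settled before [d] and [M]: gauges for the transform at [sigma] may vary with [sigma],
     the radius may not. Dividing tails and middle separately makes [- N] and [N] division
     points. *)
  exists h0. repeat split; auto. intros d M Hd.
  set (c := Rmax N (M + 1)).
  assert (Hc : N <= c /\ M + 1 <= c) by (split; [apply Rmax_l | apply Rmax_r]).
  set (dd := fun x => Rmin (d x) (dc x)).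
  assert (Hdd : gauge dd) by (apply gauge_Rmin; auto).
  destruct (cousin dd (- c) (- N) Hdd ltac:(lra)) as [P1 T1].
  destruct (cousin dd (- N) N Hdd ltac:(lra)) as [P2 T2].
  destruct (cousin dd N c Hdd ltac:(lra)) as [P3 T3].
  destruct (tdiv_Rmin _ _ _ _ _ T1) as [T1d T1c].
  destruct (tdiv_Rmin _ _ _ _ _ T2) as [T2d T2c].
  destruct (tdiv_Rmin _ _ _ _ _ T3) as [T3d T3c].
  exists (- c), c, (P1 ++ P2 ++ P3). split; [lra|]. split; [lra|]. split.
  { eapply tdiv_app; [apply T1d|]. eapply tdiv_app; eauto. }
  intros sigma Hsig. assert (Hs2 : Rabs (sigma - s) <= Rabs s / 2) by lra.
  set (k := fun x => cos (sigma * x + th) - cos (s * x + th)).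
  set (K := fun x => / sigma * sin (sigma * x + th) - / s * sin (s * x + th)).
  assert (Hk : kernel k K (3 * Rabs s)) by (apply kernel_cos_difference; auto).
  assert (Hbig : forall x, Rabs (k x) <= B0 /\ Rabs (K x) <= B0)
    by (intros; apply kernel_cos_difference_bound; auto).
  destruct (Hsum k K _ _ P1 B0 Hk T1c (fun x _ => Hbig x)) as [_ F1].
  destruct (Hsum k K _ _ P3 B0 Hk T3c (fun x _ => Hbig x)) as [_ F3].
  destruct (Hsum k K _ _ P2 (Rabs (sigma - s) * D) Hk T2c) as [F2 _].
  { intros x Hx. apply kernel_cos_difference_small; auto. apply Rabs_le; lra. }
  specialize (F1 ltac:(lra)). specialize (F2 ltac:(lra) ltac:(lra)). specialize (F3 ltac:(lra)).
  replace (rsum (fun x => cos (sigma * x + th) * g x) (- c) (P1 ++ P2 ++ P3)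
     - rsum (fun x => cos (s * x + th) * g x) (- c) (P1 ++ P2 ++ P3))
    with (1 * rsum (fun x => cos (sigma * x + th) * g x) (- c) (P1 ++ P2 ++ P3)
     + (-1) * rsum (fun x => cos (s * x + th) * g x) (- c) (P1 ++ P2 ++ P3)) by ring.
  rewrite <- rsum_lin.
  rewrite (rsum_ext _ (fun x => k x * g x)) by (intros; unfold k; ring).
  rewrite (rsum_app dd _ _ (- N)), (rsum_app dd _ _ N) by auto.
  assert (B1 : B0 * (eps / (8 * B0)) = eps / 8) by (field; lra).
  assert (B2 : Rabs (sigma - s) * D * V <= eps / 4).
  { rewrite Rmult_assoc. apply Rle_trans with (eps / (4 * (D * V + 1)) * (D * V)).
    - apply Rmult_le_compat_r; lra.
    - assert (E : eps / (4 * (D * V + 1)) * (D * V + 1) = eps / 4) by (field; lra). lra. }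
  apply Rabs_le_inv in F1, F2, F3. apply Rabs_le; lra.
Qed.

(** A division fine for the gauges at both [s] and [sigma] links [G s] to [G sigma], with three
    errors of [eps / 4]. *)
Lemma continuity_cos_transform g G s th : s <> 0 -> L1_plus_BV0 g ->
  (forall s, s <> 0 -> HK_integral_R (fun x => cos (s * x + th) * g x) (G s)) ->
  continuity_pt G s.
Proof.
  intros Hs Hg HG eps Heps.
  destruct (cos_sums_equicontinuous g s th Hs Hg (eps / 4) ltac:(lra)) as [h0 [Hh0 [Hh HP]]].
  exists h0; split; auto. intros sigma [_ Hsig]. simpl in Hsig. unfold Rdist in Hsig.
  simpl. unfold Rdist.
  destruct (frequency_gap s sigma Hs ltac:(lra)) as [Hsig0 _].
  destruct (HG s Hs (eps / 4) ltac:(lra)) as [d1 [M1 [Hd1 [_ E1]]]].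
  destruct (HG sigma Hsig0 (eps / 4) ltac:(lra)) as [d2 [M2 [Hd2 [_ E2]]]].
  assert (A1 := Rmax_l M1 M2). assert (A2 := Rmax_r M1 M2).
  destruct (HP (fun x => Rmin (d1 x) (d2 x)) (Rmax M1 M2) (gauge_Rmin _ _ Hd1 Hd2))
    as [a [b [P [Ha [Hb [HT E]]]]]].
  apply tdiv_Rmin in HT as [HT1 HT2].
  specialize (E1 a b P ltac:(lra) ltac:(lra) HT1).
  specialize (E2 a b P ltac:(lra) ltac:(lra) HT2).
  specialize (E sigma ltac:(lra)).
  apply Rabs_def2 in E1, E2. apply Rabs_le_inv in E. apply Rabs_def1; lra.
Qed.

(** As [- sin y = cos (y + PI / 2)], differentiating in the frequency multiplies by [x] and advances
    the phase by a quarter turn, so the result is again a cosine sum. *)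
Lemma derivable_pt_lim_rsum_cos f th a P s :
  derivable_pt_lim (fun s => rsum (fun x => cos (s * x + th) * f x) a P) s
    (rsum (fun x => cos (s * x + (th + PI / 2)) * (x * f x)) a P).
Proof.
  revert a; induction P as [|[t c] P IH]; intros a; simpl.
  - apply derivable_pt_lim_const.
  - apply (derivable_pt_lim_plus (fun s => cos (s * t + th) * f t * (c - a))
      (fun s => rsum (fun x => cos (s * x + th) * f x) c P)); auto.
    replace (cos (s * t + (th + PI / 2)) * (t * f t) * (c - a))
      with ((- sin (s * t + th) * t) * (f t * (c - a)) + cos (s * t + th) * 0).
    2: { replace (s * t + (th + PI / 2)) with ((s * t + th) + PI / 2) by ring.
         rewrite (cos_plus (s * t + th) (PI / 2)), cos_PI2, sin_PI2. ring. }
    apply derivable_pt_lim_ext with (fun s => cos (s * t + th) * (f t * (c - a))).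
    { intros; ring. }
    apply (derivable_pt_lim_mult (fun s => cos (s * t + th)) (fun _ => f t * (c - a)));
      [|apply derivable_pt_lim_const].
    replace (- sin (s * t + th) * t) with (- sin (s * t + th) * ((1 * t + s * 0) + 0)) by ring.
    apply (derivable_pt_lim_comp (fun s => s * t + th) cos); [|apply derivable_pt_lim_cos].
    apply derivable_pt_lim_plus; [|apply derivable_pt_lim_const].
    apply (derivable_pt_lim_mult (fun s => s) (fun _ => t));
      [apply derivable_pt_lim_id | apply derivable_pt_lim_const].
Qed.

Lemma MVT_between F F' x y : (forall z, derivable_pt_lim F z (F' z)) ->
  exists z, F y - F x = F' z * (y - x) /\ Rabs (z - x) <= Rabs (y - x).
Proof.
  intros HF. destruct (Rtotal_order x y) as [Hl|[->|Hg]].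
  - destruct (MVT_cor2 F F' x y Hl) as [z [Hz Hzi]]; auto.
    exists z; split; auto. rewrite !Rabs_right; lra.
  - exists y. split; [ring | lra].
  - destruct (MVT_cor2 F F' y x Hg) as [z [Hz Hzi]]; auto.
    exists z; split; [lra|]. rewrite !Rabs_left; lra.
Qed.

(* The mean value theorem is applied to one finite sum approximating all three integrals; equicontinuity absorbs the unknown intermediate frequency. *)
Lemma derivable_cos_transform f F G s th : s <> 0 -> L1_plus_BV0 (fun x => x * f x) ->
  (forall s, s <> 0 -> HK_integral_R (fun x => cos (s * x + th) * f x) (F s)) ->
  (forall s, s <> 0 -> HK_integral_R (fun x => cos (s * x + (th + PI / 2)) * (x * f x)) (G s)) ->
  derivable_pt_lim F s (G s).
Proof.
  intros Hs Hg HF HG eps Heps.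
  destruct (cos_sums_equicontinuous _ s (th + PI / 2) Hs Hg (eps / 4) ltac:(lra))
    as [h0 [Hh0 [Hh HP]]].
  exists (mkposreal h0 Hh0). intros h Hne Hlt. simpl in Hlt.
  assert (Hha := Rabs_pos_lt h Hne).
  destruct (frequency_gap s (s + h) Hs) as [Hsh _].
  { replace (s + h - s) with h by ring. lra. }
  (* Two errors [e] divided by [|h|] make [eps / 4]. The gauges below may depend on [h], as [h0] is
     already fixed. *)
  set (e := eps * Rabs h / 8).
  assert (He : 0 < e) by (unfold e; apply Rdiv_lt_0_compat; [apply Rmult_lt_0_compat|]; lra).
  destruct (HF s Hs e He) as [d1 [M1 [Hd1 [_ E1]]]].
  destruct (HF (s + h) Hsh e He) as [d2 [M2 [Hd2 [_ E2]]]].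
  destruct (HG s Hs (eps / 4) ltac:(lra)) as [d3 [M3 [Hd3 [_ E3]]]].
  assert (A1 := Rmax_l M1 (Rmax M2 M3)). assert (A2 := Rmax_r M1 (Rmax M2 M3)).
  assert (A3 := Rmax_l M2 M3). assert (A4 := Rmax_r M2 M3).
  destruct (HP (fun x => Rmin (d1 x) (Rmin (d2 x) (d3 x))) (Rmax M1 (Rmax M2 M3))
    (gauge_Rmin _ _ Hd1 (gauge_Rmin _ _ Hd2 Hd3))) as [a [b [P [Ha [Hb [HT E]]]]]].
  apply (tdiv_Rmin d1 (fun x => Rmin (d2 x) (d3 x))) in HT as [HT1 HT].
  apply tdiv_Rmin in HT as [HT2 HT3].
  specialize (E1 a b P ltac:(lra) ltac:(lra) HT1).
  specialize (E2 a b P ltac:(lra) ltac:(lra) HT2).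
  specialize (E3 a b P ltac:(lra) ltac:(lra) HT3).
  destruct (MVT_between _ _ s (s + h) (derivable_pt_lim_rsum_cos f th a P)) as [z [Hz Hzs]].
  replace (s + h - s) with h in Hz, Hzs by ring.
  specialize (E z ltac:(lra)).
  set (Tz := rsum (fun x => cos (z * x + (th + PI / 2)) * (x * f x)) a P) in *.
  set (Ts := rsum (fun x => cos (s * x + (th + PI / 2)) * (x * f x)) a P) in *.
  set (S1 := rsum (fun x => cos (s * x + th) * f x) a P) in *.
  set (S2 := rsum (fun x => cos ((s + h) * x + th) * f x) a P) in *.
  (* By [Hz] the residue [S2 - S1 - Tz * h] is zero, leaving integration errors and [Tz - G s]. *)
  replace ((F (s + h) - F s) / h - G s)
    with (((F (s + h) - S2) - (F s - S1) + (S2 - S1 - Tz * h)) / h + (Tz - G s)) by (field; auto).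
  rewrite Hz.
  assert (E4 : Rabs ((F (s + h) - S2 - (F s - S1) + (Tz * h - Tz * h)) / h) <= eps / 4).
  { unfold Rdiv. rewrite Rabs_mult, Rabs_inv.
    replace (eps * / 4) with (2 * e * / Rabs h) by (unfold e; field; lra).
    apply Rmult_le_compat_r; [apply Rlt_le, Rinv_0_lt_compat; auto|].
    apply Rabs_def2 in E1, E2. apply Rabs_le; lra. }
  apply Rabs_def2 in E3. apply Rabs_le_inv in E, E4. apply Rabs_def1; lra.
Qed.

(** * The cosine and sine transforms and the final assembly *)

Lemma HK_int_cos g s : s <> 0 -> L1_plus_BV0 g ->
  HK_integral_R (fun x => cos (s * x) * g x) (HK_int (fun x => cos (s * x) * g x)).
Proof.
  intros Hs Hg. apply HK_int_spec. destruct (integrable_cos_mult g s 0 Hs Hg) as [I HI].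
  exists I. eapply HK_ext; [|exact HI]. intros x; simpl. now rewrite Rplus_0_r.
Qed.

Lemma sin_as_cos y : sin y = cos (y - PI / 2).
Proof. rewrite cos_minus, cos_PI2, sin_PI2. ring. Qed.

Lemma HK_int_sin g s : s <> 0 -> L1_plus_BV0 g ->
  HK_integral_R (fun x => sin (s * x) * g x) (HK_int (fun x => sin (s * x) * g x)).
Proof.
  intros Hs Hg. apply HK_int_spec. destruct (integrable_cos_mult g s (- (PI / 2)) Hs Hg) as [I HI].
  exists I. eapply HK_ext; [|exact HI]. intros x; simpl. now rewrite sin_as_cos.
Qed.

(* d/ds F(f)(s) = -i F(g)(s):  -i (a + i b) = b - i a. *)
Theorem mainTheorem5 (f : R -> R) :
  L1_plus_BV0 f ->
  L1_plus_BV0 (fun t => t * f t) ->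
  forall s, s <> 0 ->
    derivable_pt_lim (FHK_re f) s (FHK_im (fun t => t * f t) s) /\
    derivable_pt_lim (FHK_im f) s (- FHK_re (fun t => t * f t) s) /\
    continuity_pt (FHK_re (fun t => t * f t)) s /\
    continuity_pt (FHK_im (fun t => t * f t)) s.
Proof.
  intros Hf Hg s Hs. set (g := fun t => t * f t) in *.
  set (c := / sqrt (2 * PI)).
  set (Cf := fun s => HK_int (fun x => cos (s * x) * f x)).
  set (Sf := fun s => HK_int (fun x => sin (s * x) * f x)).
  set (Cg := fun s => HK_int (fun x => cos (s * x) * g x)).
  set (Sg := fun s => HK_int (fun x => sin (s * x) * g x)).
  assert (HCf : derivable_pt_lim Cf s (-1 * Sg s)).
  (* Phase 0 is the cosine; its derivative has phase [PI / 2], that is, minus the sine. *)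
  { apply (derivable_cos_transform f Cf (fun s => -1 * Sg s) s 0 Hs Hg).
    - intros r Hr. eapply HK_ext; [|apply (HK_int_cos f r Hr Hf)].
      intros x; simpl. now rewrite Rplus_0_r.
    - intros r Hr. assert (HS := HK_int_sin g r Hr Hg).
      (* Scaling by -1 is a combination whose second coefficient is 0. *)
      assert (H := HK_lin (-1) _ _ 0 _ _ HS HS).
      replace (-1 * Sg r) with (-1 * Sg r + 0 * Sg r) by ring.
      eapply HK_ext; [|exact H]. intros x; simpl.
      rewrite Rplus_0_l, cos_plus, cos_PI2, sin_PI2. unfold g; ring. }
  assert (HSf : derivable_pt_lim Sf s (Cg s)).
  (* Phase [- PI / 2] is the sine; its derivative returns to phase 0, the cosine. *)
  { apply (derivable_cos_transform f Sf Cg s (- (PI / 2)) Hs Hg).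
    - intros r Hr. eapply HK_ext; [|apply (HK_int_sin f r Hr Hf)].
      intros x; simpl. now rewrite sin_as_cos.
    - intros r Hr. eapply HK_ext; [|apply (HK_int_cos g r Hr Hg)].
      intros x; simpl. now rewrite Rplus_opp_l, Rplus_0_r. }
  assert (HCg : continuity_pt Cg s).
  { apply (continuity_cos_transform g Cg s 0 Hs Hg). intros r Hr.
    eapply HK_ext; [|apply (HK_int_cos g r Hr Hg)].
    intros x; simpl. now rewrite Rplus_0_r. }
  assert (HSg : continuity_pt Sg s).
  { apply (continuity_cos_transform g Sg s (- (PI / 2)) Hs Hg). intros r Hr.
    eapply HK_ext; [|apply (HK_int_sin g r Hr Hg)].
    intros x; simpl. now rewrite sin_as_cos. }
  repeat split.
  - replace (FHK_im g s) with (c * (-1 * Sg s)) by (unfold FHK_im; fold c; fold (Sg s); ring).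
    exact (derivable_pt_lim_scal Cf c s _ HCf).
  - exact (derivable_pt_lim_opp _ s _ (derivable_pt_lim_scal Sf c s _ HSf)).
  - exact (continuity_pt_scal Cg c s HCg).
  - exact (continuity_pt_opp _ s (continuity_pt_scal Sg c s HSg)).
Qed.
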